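(* Let $S^1=\{(x,y)\in\mathbb{R}^2:x^2+y^2=1\}$ be the standard unit circle endowed with its intrinsic (arc-length) metric, and for a real number $\lambda\ge 0$ let $I_\lambda=[0,\lambda]\subset\mathbb{R}$ be the segment of length $\lambda$ with the metric induced from $\mathbb{R}$. Then $$ d_{GH}(I_\lambda,S^1)= \begin{cases} \dfrac{\pi}{2}-\dfrac{\lambda}{4} & \text{for } 0\le\lambda\le\dfrac{2}{3}\pi,\\[8pt] \dfrac{\pi}{3} & \text{for } \dfrac{2}{3}\pi\le\lambda\le\dfrac{5}{3}\pi,\\[8pt] \dfrac{\lambda-\pi}{2} & \text{for } \lambda\ge\dfrac{5}{3}\pi. \end{cases} $$
   Context: The distance between points $p,q$ of a metric space is denoted $|pq|$. A correspondence between nonempty sets $X$ and $Y$ is a subset $R\subset X\times Y$ such that every $x\in X$ satisfies $(x,y)\in R$ for some $y\in Y$, and every $y\in Y$ satisfies $(x,y)\in R$ for some $x\in X$; $\mathcal{R}(X,Y)$ is the set of all correspondences. For metric spaces $X,Y$ and $R\in\mathcal{R}(X,Y)$, the distortion is $\operatorname{dis}R=\sup\{\,\bigl||x_1x_2|-|y_1y_2|\bigr| : (x_1,y_1),(x_2,y_2)\in R\}$. The Gromov--Hausdorff distance is $d_{GH}(X,Y)=\frac12\inf\{\operatorname{dis}R : R\in\mathcal{R}(X,Y)\}$. The intrinsic metric on $S^1$: the distance between the points with angles $\varphi_1,\varphi_2\in[-\pi,\pi]$ is $\min\{|\varphi_1-\varphi_2|,\,2\pi-|\varphi_1-\varphi_2|\}$,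 so $S^1$ has diameter $\pi$. *)

(* Defs.v *)
From HB Require Import structures.
From mathcomp Require Import all_boot all_order all_algebra.
From mathcomp Require Import all_classical all_reals all_analysis.
From mathcomp Require Import lra.

Set Implicit Arguments.
Unset Strict Implicit.
Unset Printing Implicit Defensive.

Import Order.TTheory GRing.Theory Num.Theory.
Import numFieldNormedType.Exports.

Local Open Scope classical_set_scope.
Local Open Scope ring_scope.

Definition correspondence (X Y : Type) : set (set (X * Y)) :=
  [set C | (forall x, exists y, C (x, y)) /\ (forall y, exists x, C (x, y))].

(* Suprema and infima are taken in \bar R: the distortion may be infinite, and
   a real-valued sup would silently return 0 on unbounded sets. *)
Definition distortion (R : realType) (X Y : metricType R) (C : set (X * Y)) :
    \bar R :=
  ereal_sup [set (`| mdist p.1 q.1 - mdist p.2 q.2 |)%:E | p in C & q in C].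

Definition dGH (R : realType) (X Y : metricType R) : \bar R :=
  ((2^-1)%:E * ereal_inf [set distortion C | C in @correspondence X Y])%E.

Definition segment (R : realType) (l : R) := {x : R | x \in `[0, l]}.

HB.instance Definition _ (R : realType) (l : R) := Choice.on (segment l).

Section segment_metric.
Context {R : realType} {l : R}.
Implicit Types x y z : segment l.

Definition segment_dist x y : R := `| val x - val y |.

Lemma segment_distxx x : segment_dist x x = 0.
Proof. by rewrite /segment_dist subrr normr0. Qed.

Lemma segment_dist_eq0 x y : segment_dist x y = 0 -> x = y.
Proof. by move/normr0_eq0/eqP; rewrite subr_eq0 => /eqP/val_inj. Qed.

Lemma segment_distC x y : segment_dist x y = segment_dist y x.
Proof. exact: distrC. Qed.

Lemma segment_dist_triangle y x z :
  segment_dist x z <= segment_dist x y + segment_dist y z.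
Proof. exact: ler_distD. Qed.

End segment_metric.

HB.instance Definition _ (R : realType) (l : R) :=
  @isMetric.Build R (segment l) segment_dist segment_distxx segment_dist_eq0
    segment_distC segment_dist_triangle.

Definition circle (R : realType) := {p : R * R | p.1 ^+ 2 + p.2 ^+ 2 == 1}.

HB.instance Definition _ (R : realType) := Choice.on (circle R).

Section circle_metric.
Context {R : realType}.
Implicit Types p q r : circle R.

Lemma circle_subproof (a : R) : (cos a, sin a).1 ^+ 2 + (cos a, sin a).2 ^+ 2 == 1.
Proof. by rewrite /= cos2Dsin2. Qed.

Definition circle_point (a : R) : circle R :=
  exist (fun p : R * R => p.1 ^+ 2 + p.2 ^+ 2 == 1) _ (circle_subproof a).

(* the angle in ]-pi, pi], see angle_itv and angleK *)
Definition angle p : R :=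
  if 0 <= (val p).2 then acos (val p).1 else - acos (val p).1.

Definition angle_dist (a b : R) : R :=
  Num.min `|a - b| (2 * pi - `|a - b|).

Definition circle_dist p q : R := angle_dist (angle p) (angle q).

Lemma circle_fst_bound p : -1 <= (val p).1 <= 1.
Proof.
case: p => -[x y] /= /eqP xy1.
by rewrite -ler_norml -(expr_le1 (n := 2))// real_normK ?num_real//; nra.
Qed.

Lemma angle_itv p : - pi < angle p <= pi.
Proof.
have pb := circle_fst_bound p.
have a0 := acos_ge0 pb; have api := acos_lepi pb; have pi0 := pi_gt0 R.
rewrite /angle; case: ifPn => [_|]; first by apply/andP; split; lra.
rewrite -ltNge => y0.
suff : acos (val p).1 < pi by move=> ?; apply/andP; split; lra.
apply: acos_ltpi; case/andP: pb => pb1 ->; rewrite andbT lt_neqAle pb1 andbT.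
apply/eqP => x1; case: p y0 x1 {pb1 a0 api} => -[x y] /= /eqP xy1 y0 x1.
by nra.
Qed.

Lemma circle_pointK a : - pi < a <= pi -> angle (circle_point a) = a.
Proof.
move=> /andP[a1 a2]; rewrite /angle /=; case: ifPn => s0.
- case: (leP 0 a) => a0; first by rewrite cosK// in_itv/= a0.
  have : 0 < sin (- a) by apply: sin_gt0_pi; apply/andP; split; lra.
  by rewrite sinN; lra.
- case: (leP 0 a) => a0.
    have := @sin_ge0_pi R a; rewrite a0 a2 => /(_ isT).
    by rewrite (negbTE s0).
  by rewrite cosKN ?opprK//; apply/andP; split; lra.
Qed.

Lemma angleK p : circle_point (angle p) = p.
Proof.
have pb := circle_fst_bound p.
apply/val_inj => /=; rewrite /angle; case: p pb => -[x y] /= /eqP xy1 pb.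
have y2 : 1 - x ^+ 2 = y ^+ 2 by rewrite -xy1 addrC addKr.
case: ifPn => y0; rewrite ?cosN ?sinN acosK ?in_itv//= sin_acos// y2 sqrtr_sqr.
- by rewrite ger0_norm.
- by rewrite ltr0_norm ?opprK// ltNge.
Qed.

Lemma circle_distxx p : circle_dist p p = 0.
Proof.
rewrite /circle_dist /angle_dist subrr normr0 subr0.
by apply/min_idPl; have := pi_gt0 R; lra.
Qed.

Lemma circle_dist_eq0 p q : circle_dist p q = 0 -> p = q.
Proof.
move=> pq0; suff : angle p = angle q.
  by move=> pq; rewrite -(angleK p) pq angleK.
have /andP[p1 p2] := angle_itv p; have /andP[q1 q2] := angle_itv q.
move: pq0; rewrite /circle_dist /angle_dist.
by case: leP => ?; case: ger0P => ?; lra.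
Qed.

Lemma circle_distC p q : circle_dist p q = circle_dist q p.
Proof. by rewrite /circle_dist /angle_dist distrC. Qed.

Lemma circle_dist_triangle q p r :
  circle_dist p r <= circle_dist p q + circle_dist q r.
Proof.
rewrite /circle_dist /angle_dist; set a := angle p; set b := angle q.
set c := angle r.
have abc := ler_distD b a c; have acb := ler_distD c a b.
have bac := ler_distD a b c.
rewrite (distrC c b) in acb; rewrite (distrC b a) in bac.
have sum4pi : `|a - b| + `|b - c| + `|a - c| <= 4 * pi.
  have /andP[a1 a2] : - pi < a <= pi by exact: angle_itv.
  have /andP[b1 b2] : - pi < b <= pi by exact: angle_itv.
  have /andP[c1 c2] : - pi < c <= pi by exact: angle_itv.
  by case: ger0P => ?; case: ger0P => ?; case: ger0P => ?; lra.
move: abc acb bac sum4pi; move: `|a - b| `|b - c| `|a - c| => u v w *.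
by rewrite ge_min; case: (leP u) => ?; case: (leP v) => ?; apply/orP;
  ((by left; lra) || (by right; lra)).
Qed.

End circle_metric.

HB.instance Definition _ (R : realType) :=
  @isMetric.Build R (circle R) circle_dist circle_distxx circle_dist_eq0
    circle_distC circle_dist_triangle.

(* The endpoints -pi and pi denote the same point; the distance formula does
   not depend on which angle is used. *)
Lemma mdist_circle_point (R : realType) (a b : R) :
    - pi <= a <= pi -> - pi <= b <= pi ->
  mdist (circle_point a) (circle_point b) =
    Num.min `|a - b| (2 * pi - `|a - b|).
Proof.
have pi0 := pi_gt0 R.
have ptNpi : circle_point (- pi) = circle_point pi :> circle R.
  by apply/val_inj; rewrite /= cosN sinN sinpi oppr0.
suff H (c : R) : - pi <= c <= pi -> exists2 d, - pi < d <= pi &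
    circle_point c = circle_point d /\ (c = d \/ c = - pi /\ d = pi).
  move=> /H[c cpi [-> ac]] /H[d dpi [-> bd]].
  rewrite [LHS]/(angle_dist _ _) !circle_pointK// /angle_dist.
  case/andP: cpi => c1 c2; case/andP: dpi => d1 d2.
  case: ac => [->|[-> ac]]; case: bd => [->|[-> bd]]//; rewrite /Num.min.
  - rewrite bd (@ler0_norm _ (c - pi)) ?(@ger0_norm _ (c - - pi)); [|lra..].
    by do 2 case: ltP => ?; lra.
  - rewrite ac (@ger0_norm _ (pi - d)) ?(@ler0_norm _ (- pi - d)); [|lra..].
    by do 2 case: ltP => ?; lra.
  - by rewrite ac bd !subrr.
rewrite le_eqVlt => /andP[/orP[/eqP<-|c1] c2].
- by exists pi; [apply/andP; split; lra | split=> //; right].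
- by exists c; [rewrite c1 | split=> //; left].
Qed.

(* Main.v *)
Require Import Defs.
From HB Require Import structures.
From mathcomp Require Import all_boot all_order all_algebra.
From mathcomp Require Import all_classical all_reals all_analysis.
From mathcomp Require Import lra.

Import Order.TTheory GRing.Theory Num.Theory.
Import numFieldNormedType.Exports.

(** Write [l] for the length of the segment. The three values of the distance are
one formula: the least distortion of a correspondence between the segment and
the circle is the largest of the numbers [pi - l / 2], [2 / 3 * pi] and
[l - pi]; the ranges of the theorem say which of the three is the largest.

Lower bounds. [l - pi] compares diameters ([distortion_ge_diam]). For
[pi - l / 2], take a point of the circle related to the midpoint of the segment:
its antipode is at distance [pi] from it, while every point of the segment is
within [l / 2] of the midpoint ([distortion_ge_midpoint]). For [2 / 3 * pi]
([circle_line_distortion]), choose a real number [f p] for every [p] of the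
circle, with distortion [d < 2 / 3 * pi]. Antipodal points have values at least
[pi - d] apart, so they are strictly ordered. When one point of an antipodal
pair moves a little, its value jumps by little more than [d]; reversing the
order would take a jump of almost [2 * (pi - d)], which exceeds [d]. Moving the
two points in turn thus preserves the order all along a half turn, although the
half turn exchanges them.

Upper bound ([small_distortion_correspondence]). Put the origin of the segment
at its midpoint and let [mu = l / 2]. One half of the circle, the angles in
[[- pi / 2, pi / 2]], is matched with the segment by the curve of the points
[(clamp mu x, clamp (pi / 2) x)]: the shorter of the two intervals is embedded
isometrically in the middle of the longer, whose two excess parts are sent to the
endpoints of the shorter. Its distortion is at most [`|2 * mu - pi|]. The two
remaining quarters of the circle are collapsed to the values [m] and [- m], with
[m] the smaller of [mu] and half of the target distortion [d]. Points of
different quarters, which may be close or antipodal, then have values [2 * m]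
apart, with [pi - d <= 2 * m <= d]. *)

Local Open Scope classical_set_scope.
Local Open Scope ring_scope.

(** * Reduction to real inequalities *)

(** The bound [d] runs over the reals although the distortion may be infinite:
if it is [+oo] there is nothing to prove, and if it is [-oo] the set [C] is
empty, so that the assumption applies to [d = b - 1]. *)
Lemma le_distortion {R : realType} (X Y : metricType R) (C : set (X * Y))
    (b : R) :
  (forall d : R, (forall p q, C p -> C q ->
      `|mdist p.1 q.1 - mdist p.2 q.2| <= d) -> b <= d) ->
  (b%:E <= distortion C)%E.
Proof.
move=> bP.
have ub p q : C p -> C q ->
    ((`|mdist p.1 q.1 - mdist p.2 q.2|)%:E <= distortion C)%E.
  by move=> Cp Cq; apply: ereal_sup_ubound; exists p => //; exists q.
case: (distortion C) ub => [r| |] ub; last 2 first.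
- exact: leey.
- exfalso; have : b <= b - 1; last by lra.
  by apply: bP => p q Cp Cq; have := ub p q Cp Cq; rewrite leeNy_eq.
- rewrite lee_fin; apply: bP => p q Cp Cq.
  by have := ub p q Cp Cq; rewrite lee_fin.
Qed.

Lemma distortion_le {R : realType} (X Y : metricType R) (C : set (X * Y))
    (d : R) :
  (forall p q, C p -> C q -> `|mdist p.1 q.1 - mdist p.2 q.2| <= d) ->
  (distortion C <= d%:E)%E.
Proof.
by move=> dP; apply: ge_ereal_sup => _ [p Cp [q Cq <-]]; rewrite lee_fin dP.
Qed.

Lemma dGH_eq_half {R : realType} (X Y : metricType R) (d : R) :
  (forall C, @correspondence X Y C -> (d%:E <= distortion C)%E) ->
  (exists2 C, @correspondence X Y C & (distortion C <= d%:E)%E) ->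
  dGH X Y = (d / 2)%:E.
Proof.
move=> lb [C corrC Cd]; rewrite /dGH.
suff -> : ereal_inf [set distortion C | C in @correspondence X Y] = d%:E.
  by rewrite -EFinM mulrC.
apply/eqP; rewrite eq_le; apply/andP; split.
  by apply: le_trans Cd; apply: ereal_inf_lbound; exists C.
by apply: le_ereal_inf_tmp => _ [C' corrC' <-]; apply: lb.
Qed.

(** * Lower bounds for the distortion *)

Lemma mdist_segment {R : realType} (l : R) (s t : segment l) :
  mdist s t = `|val s - val t|.
Proof. by []. Qed.

Lemma mdist_circle {R : realType} (p q : circle R) :
  mdist p q = angle_dist (angle p) (angle q).
Proof. by []. Qed.

Lemma angle_dist_lepi {R : realType} (a b : R) : angle_dist a b <= pi.
Proof.
by rewrite /angle_dist /Num.min; case: ltP => h; lra.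
Qed.

Lemma circle_antipode {R : realType} (p : circle R) :
  exists q : circle R, mdist p q = pi.
Proof.
have p0 := pi_gt0 R; have /andP[a1 a2] := angle_itv p.
rewrite -(angleK p).
have [a0|a0] := ltP 0 (angle p).
- exists (circle_point (angle p - pi)).
  rewrite mdist_circle_point; [|apply/andP; split; lra..].
  by case: leP; case: ger0P; lra.
- exists (circle_point (angle p + pi)).
  rewrite mdist_circle_point; [|apply/andP; split; lra..].
  by case: leP; case: ger0P; lra.
Qed.

Lemma distortion_ge_diam {R : realType} (l : R)
    (C : set (segment l * circle R)) : 0 <= l ->
  correspondence C -> ((l - pi)%:E <= distortion C)%E.
Proof.
move=> l_ge0 corrC; apply: le_distortion => d dP.
have i0 : (0 : R) \in `[0, l] by rewrite in_itv/= lexx.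
have il : l \in `[0, l] by rewrite in_itv/= lexx andbT.
have [p Cp] := corrC.1 (exist _ 0 i0); have [q Cq] := corrC.1 (exist _ l il).
have := dP _ _ Cp Cq; have := angle_dist_lepi (angle p) (angle q).
rewrite /= mdist_segment mdist_circle (distrC (val _)) subr0 (ger0_norm l_ge0).
by case: ger0P; lra.
Qed.

Lemma distortion_ge_midpoint {R : realType} (l : R)
    (C : set (segment l * circle R)) : 0 <= l ->
  correspondence C -> ((pi - l / 2)%:E <= distortion C)%E.
Proof.
move=> l_ge0 corrC; apply: le_distortion => d dP.
have im : l / 2 \in `[0, l] by rewrite in_itv/=; apply/andP; split; lra.
have [p Cp] := corrC.1 (exist _ (l / 2) im).
have [q pq] := circle_antipode p.
have [[s si] Cs] := corrC.2 q.
have := dP _ _ Cp Cs; rewrite /= mdist_segment pq ler_norml /=.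
have := si; rewrite in_itv/= => /andP[s0 sl].
by case: ger0P; lra.
Qed.

(** Since [f p] and [f p'] are both at least [r - d] away from [f q], they can lie
on different sides of it only if they are [2 * (r - d)] apart, whereas they are
at most [mdist p p' + d] apart. *)
Lemma far_comparison_stable {R : realType} (T : metricType R) (f : T -> R)
    (d r : R) :
  (forall p q, `| `|f p - f q| - mdist p q| <= d) ->
  forall p p' q, r <= mdist p q -> r <= mdist p' q ->
    mdist p p' + 3 * d < 2 * r ->
  ((f p < f q) = (f p' < f q)) * ((f q < f p) = (f q < f p')).
Proof.
move=> fd p p' q rp rp' pp'.
have := fd p q; have := fd p' q; have := fd p p'; have d0 := fd p p.
have d_ge0 : 0 <= d by apply: le_trans d0.
rewrite !ler_norml => /andP[_ h1] /andP[h2 _] /andP[h3 _].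
have : r - d <= `|f p - f q| by lra.
have : r - d <= `|f p' - f q| by lra.
have : `|f p - f p'| <= mdist p p' + d by lra.
have := mdist_ge0 p p'.
rewrite ler_norml !ler_normr => pp0 /andP[k1 k2] /orP k3 /orP k4.
by case: k3; case: k4 => ? ?; split; apply/idP/idP => ?; lra.
Qed.

(** The antipodal pairs [(x, x + pi)] are followed from [x = - pi] to [x = 0] in
[N] steps of length [e = pi / N]. During a step the two points stay at distance
at least [pi - e], so that the order of their values is kept as soon as
[e + 3 * d < 2 * (pi - e)], that is [e < 2 / 3 * pi - d]. *)
Lemma circle_line_distortion {R : realType} (f : circle R -> R) (d : R) :
  (forall p q, `| `|f p - f q| - mdist p q| <= d) -> 2 / 3 * pi <= d.
Proof.
move=> fd; rewrite leNgt; apply/negP => dlt.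
have p0 := pi_gt0 R.
pose N := (Num.bound (pi / (2 / 3 * pi - d))).+1.
have N0 : 0 < N%:R :> R by rewrite ltr0n.
have eP : pi / N%:R < 2 / 3 * pi - d.
  rewrite ltr_pdivrMr // mulrC -ltr_pdivrMr; last lra.
  apply: lt_trans (_ : _ < (Num.bound (pi / (2 / 3 * pi - d)))%:R) _.
    by apply: archi_boundP; apply: divr_ge0; lra.
  by rewrite ltr_nat.
set e := pi / N%:R in eP.
have e0 : 0 < e by rewrite divr_gt0.
have Ne : N%:R * e = pi by rewrite mulrC divfK // gt_eqF.
pose P x := f (circle_point x).
(* The last pair (0, pi) is the first pair (- pi, 0) in reverse order. *)
have ptpi : circle_point (- pi) = circle_point pi :> circle R.
  by apply/val_inj; rewrite /= cosN sinN sinpi oppr0.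
have dist (x y : R) : - pi <= x <= y -> y <= pi -> y - x <= pi ->
    mdist (circle_point x) (circle_point y) = y - x.
  move=> /andP[x1 xy] y2 yx.
  rewrite mdist_circle_point; try (apply/andP; split; lra).
  by rewrite distrC ger0_norm ?min_l //; lra.
have step (x : R) : - pi <= x -> x + e <= 0 ->
    (P x < P (x + pi)) = (P (x + e) < P (x + e + pi)).
  move=> x1 x2.
  have st := @far_comparison_stable R _ f d (pi - e) fd.
  have [|||-> _] := st (circle_point x) (circle_point (x + e))
    (circle_point (x + pi)); try (rewrite dist; lra).
  have [|||_ ->//] := st (circle_point (x + pi)) (circle_point (x + e + pi))
    (circle_point (x + e));
    try (rewrite ?[mdist _ (circle_point (x + e))]metric_sym dist; lra).
have same_order k : (k <= N)%N ->
    (P (- pi) < P 0) = (P (- pi + k%:R * e) < P (- pi + k%:R * e + pi)).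
  elim: k => [_|k IH kN]; first by rewrite mul0r addr0 addNr.
  rewrite IH; last exact: ltnW.
  have : k.+1%:R * e <= pi by rewrite -Ne ler_pM2r // ler_nat.
  have k0 : 0 <= k%:R * e by rewrite mulr_ge0 // ltW.
  rewrite -addn1 natrD mulrDl mul1r (addrA (- pi)) => ke.
  by apply: step; lra.
have := same_order N (leqnn N); rewrite Ne addNr add0r /P -ptpi.
have := fd (circle_point (- pi)) (circle_point 0).
rewrite dist; try lra.
by case: ltgtP => // -> + _; rewrite subrr normr0 sub0r normrN ger0_norm; lra.
Qed.

Lemma distortion_ge_circle_line {R : realType} (l : R)
    (C : set (segment l * circle R)) :
  correspondence C -> ((2 / 3 * pi)%:E <= distortion C)%E.
Proof.
move=> [_ /choice[g gC]]; apply: le_distortion => d dP.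
apply: (@circle_line_distortion R (fun p => val (g p))) => p q.
exact: (dP _ _ (gC p) (gC q)).
Qed.

(** * A correspondence of small distortion *)

Definition clamp {R : realType} (c x : R) : R := Num.max (- c) (Num.min x c).

Section UpperBound.
Context {R : realType}.
Implicit Types c d l m mu u v x : R.

(** The coordinate [u] is centered at the midpoint of the segment of length
[2 * mu]. Clamping both coordinates of one parameter lets the first piece exhaust
[[- mu, mu]] and [[- pi / 2, pi / 2]] at once: the isometric diagonal is prolonged
at each end by a stretch along which only the longer coordinate moves. *)
Definition folded_arc mu m u (a : R) : Prop :=
  [\/ exists2 x, u = clamp mu x & a = clamp (pi / 2) x,
      u = m /\ pi / 2 <= a
    | u = - m /\ a <= - (pi / 2)].

Definition folding l m : set (segment l * circle R) :=
  [set p | folded_arc (l / 2) m (val p.1 - l / 2) (angle p.2)].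

Lemma clampN c x : 0 <= c -> clamp c (- x) = - clamp c x.
Proof.
move=> c0; rewrite /clamp /Num.max /Num.min.
by repeat case: ifPn; rewrite -?leNgt => *; lra.
Qed.

Lemma angle_distN (a b : R) : angle_dist (- a) (- b) = angle_dist a b.
Proof. by rewrite /angle_dist -opprD normrN. Qed.

Lemma clampP c x : 0 <= c ->
  [\/ x <= - c /\ clamp c x = - c, - c <= x <= c /\ clamp c x = x
   | c <= x /\ clamp c x = c].
Proof.
move=> c0; rewrite /clamp /Num.max /Num.min.
have [x1|x1] := leP x (- c).
  constructor 1; split => //.
  by repeat case: ifPn; rewrite -?leNgt => *; lra.
have [x2|x2] := leP x c.
  constructor 2; split; first by apply/andP; split; lra.
  by repeat case: ifPn; rewrite -?leNgt => *; lra.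
constructor 3; split; first lra.
by repeat case: ifPn; rewrite -?leNgt => *; lra.
Qed.

Lemma clamp_itv c x : 0 <= c -> - c <= clamp c x <= c.
Proof. by move=> c0; case: (clampP c x c0) => -[? ->]; lra. Qed.

(** The inequalities under which the correspondence has distortion at most [d];
[pi - m <= d] serves nearly antipodal points, one of which is in a collapsed
quarter. *)
Definition fold_bounds mu m d : Prop :=
  [/\ 0 <= m <= mu, 2 * m <= d, 2 / 3 * pi <= d, pi - m <= d
    & 2 * mu - pi <= d].

Lemma clamp_dist c c' x : 0 <= c -> 0 <= c' ->
  `|clamp c x - clamp c' x| <= `|c - c'|.
Proof.
move=> c0 c'0; have := clampP c x c0; have := clampP c' x c'0.
move: (clamp c x) (clamp c' x) => u v hv hu; rewrite ler_norml.
by case: (ger0P (c - c')) => ?; case: hu => -[? ?]; case: hv => -[? ?]; lra.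
Qed.

(** At a common parameter the two coordinates of the curve differ by at most
[`|mu - pi / 2|], so two displacements differ by at most [`|2 * mu - pi|]. The
inequality [pi - 2 * mu <= d] comes from [pi - m <= d] and [m <= 2 * mu]. *)
Lemma folded_curve_distortion mu m d x y : fold_bounds mu m d ->
  `| `|clamp mu x - clamp mu y| -
     angle_dist (clamp (pi / 2) x) (clamp (pi / 2) y)| <= d.
Proof.
move=> [/andP[m0 m_mu] m_d d_23 d_m d_mu]; have mu0 : 0 <= mu by lra.
have pi2 : 0 <= pi / 2 :> R by have := pi_gt0 R; lra.
have hx := clamp_dist mu (pi / 2) x mu0 pi2.
have hy := clamp_dist mu (pi / 2) y mu0 pi2.
have /andP[a1 a2] := clamp_itv _ x pi2; have /andP[b1 b2] := clamp_itv _ y pi2.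
(* Two angles of the same half circle: no wrap-around. *)
rewrite /angle_dist min_l; last first.
  have : `|clamp (pi / 2) x - clamp (pi / 2) y| <= pi :> R.
    by rewrite ler_norml; apply/andP; split; lra.
  by lra.
apply: le_trans (ler_dist_dist _ _) _; rewrite opprD addrACA -opprD.
apply: le_trans (ler_normB _ _) _.
apply: le_trans (lerD hx hy) _.
by case: (ger0P (mu - pi / 2)) => ?; lra.
Qed.

(** For [0 <= x] both values lie in [[0, mu]], and [m <= d] and [mu - m <= d]; if
[x <= pi / 2], the circle distance is at most [pi - x], and [m - x >= pi - d - x],
while beyond [pi / 2] it is at most [pi / 2 <= d]. For [x <= 0] the circle distance
is between [pi / 2] and [pi], and the difference of the values is between
[m >= pi - d] and [mu + m <= d + pi / 2]. *)
Lemma folded_curve_arc_distortion mu m d x (a : R) :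
  fold_bounds mu m d -> pi / 2 <= a <= pi ->
  `| `|clamp mu x - m| - angle_dist (clamp (pi / 2) x) a| <= d.
Proof.
move=> [/andP[m0 m_mu] m_d d_23 d_m d_mu]; have mu0 : 0 <= mu by lra.
have p0 := pi_gt0 R => /andP[a1 a2].
have pi2 : 0 <= pi / 2 :> R by lra.
rewrite /angle_dist.
have := clampP mu x mu0; have := clampP _ x pi2.
move: (clamp mu x) (clamp (pi / 2) x) => u b hb hu.
have ab : b - a <= 0 by case: hb => -[? ?]; lra.
rewrite (ler0_norm ab) ler_norml /Num.min.
by case: hu => -[? ?]; case: hb => -[? ?]; case: ltP => ?; case: ger0P => ?; lra.
Qed.

(** The reflection of the segment and of the circle exchanges the two quarters and
preserves the curve, so that the pairs of a curve point and a quarter reduce to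
[folded_curve_arc_distortion]. *)
Lemma folded_arc_distortion mu m d u v (a b : R) : fold_bounds mu m d ->
  - pi <= a <= pi -> - pi <= b <= pi ->
  folded_arc mu m u a -> folded_arc mu m v b ->
  `| `|u - v| - angle_dist a b| <= d.
Proof.
have p0 := pi_gt0 R.
have pi2 : 0 <= pi / 2 :> R by lra.
move=> B; have := B.
move=> [/andP[m0 m_mu] m_d d_23 d_m d_mu]; have mu0 : 0 <= mu by lra.
move=> /andP[a1 a2] /andP[b1 b2].
have ab_pi := angle_dist_lepi a b.
have ab_ge0 : 0 <= angle_dist a b.
  have : `|a - b| <= 2 * pi by rewrite ler_norml; apply/andP; split; lra.
  by have := normr_ge0 (a - b); rewrite /angle_dist le_min => -> /= ?; lra.
have near : `|a - b| <= pi / 2 -> angle_dist a b <= d.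
  by move=> ab; rewrite /angle_dist ge_min; apply/orP; left; lra.
have sym x : `|clamp mu x - - m| = `|clamp mu (- x) - m|.
  by rewrite clampN // -[RHS]normrN opprD !opprK.
have asym x c : angle_dist (clamp (pi / 2) x) c =
    angle_dist (clamp (pi / 2) (- x)) (- c).
  by rewrite clampN // angle_distN.
have adC c e : angle_dist c e = angle_dist e c.
  by rewrite /angle_dist distrC.
case=> [[x -> ->]|[-> ha]|[-> ha]]; case=> [[y -> ->]|[-> hb]|[-> hb]].
- exact: folded_curve_distortion B.
- apply: folded_curve_arc_distortion => //; apply/andP; split; lra.
- rewrite sym asym;
  apply: folded_curve_arc_distortion => //; apply/andP; split; lra.
- rewrite (distrC m) adC.
  apply: folded_curve_arc_distortion => //; apply/andP; split; lra.
- rewrite subrr normr0 sub0r normrN ger0_norm //.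
  by apply: near; rewrite ler_norml; apply/andP; split; lra.
- rewrite opprK (@ger0_norm _ (m + m)); last lra.
  by rewrite ler_norml; apply/andP; split; lra.
- rewrite (distrC (- m)) adC sym asym.
  apply: folded_curve_arc_distortion => //; apply/andP; split; lra.
- rewrite (distrC (- m)) opprK (@ger0_norm _ (m + m)); last lra.
  by rewrite ler_norml; apply/andP; split; lra.
- rewrite subrr normr0 sub0r normrN ger0_norm //.
  by apply: near; rewrite ler_norml; apply/andP; split; lra.
Qed.

Lemma clamp_id c x : - c <= x <= c -> clamp c x = x.
Proof. by move=> /andP[? ?]; rewrite /clamp min_l// max_r. Qed.

(** Every point of the segment is already met by the curve. A point of the circle
is met by a quarter, or by the curve at its own angle when that is less than
[pi / 2] in absolute value. *)
Lemma folding_correspondence l m :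
  0 <= m <= l / 2 -> correspondence (folding l m).
Proof.
move=> /andP[m0 ml]; have p0 := pi_gt0 R; split.
- move=> [s]; rewrite /= => si; have := si; rewrite in_itv/= => /andP[s0 sl].
  have /andP[c1 c2] : - (pi / 2) <= clamp (pi / 2) (s - l / 2) <= pi / 2.
    by apply: clamp_itv; lra.
  exists (circle_point (clamp (pi / 2) (s - l / 2))).
  constructor 1; exists (s - l / 2) => /=; first by rewrite clamp_id //; lra.
  by rewrite circle_pointK //; apply/andP; split; lra.
- move=> p.
  suff [u /andP[u1 u2] up] : exists2 u : R, - (l / 2) <= u <= l / 2 &
      folded_arc (l / 2) m u (angle p).
    have i : u + l / 2 \in `[0, l] by rewrite in_itv/=; apply/andP; split; lra.
    exists (exist (fun x => x \in `[0, l]) (u + l / 2) i).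
    by rewrite /folding /= addrK.
  have [a1|a1] := leP (pi / 2) (angle p).
    by exists m; [apply/andP; split; lra|constructor 2].
  have [a2|a2] := leP (angle p) (- (pi / 2)).
    by exists (- m); [apply/andP; split; lra|constructor 3].
  exists (clamp (l / 2) (angle p)); first by apply: clamp_itv; lra.
  by constructor 1; exists (angle p) => //; rewrite clamp_id //; lra.
Qed.

(** With [m] the minimum of [d / 2] and [l / 2], the bound [pi - m <= d] is
[2 / 3 * pi <= d] in the first case and [pi - l / 2 <= d] in the second. *)
Lemma small_distortion_correspondence l d : 0 <= l ->
    2 / 3 * pi <= d -> pi - l / 2 <= d -> l - pi <= d ->
  exists2 C : set (segment l * circle R), correspondence C &
    (distortion C <= d%:E)%E.
Proof.
move=> l0 d1 d2 d3; have p0 := pi_gt0 R.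
pose m := Num.min (d / 2) (l / 2).
have mP : [/\ 0 <= m, m <= l / 2, 2 * m <= d & pi - m <= d].
  by rewrite /m /Num.min; case: ltP => ?; split; lra.
case: mP => m0 m1 m2 m3; exists (folding l m).
  by apply: folding_correspondence; rewrite m0.
apply: distortion_le => -[s p] [t q] sp tq /=.
rewrite mdist_segment mdist_circle.
rewrite (_ : val s - val t = (val s - l / 2) - (val t - l / 2)); last by lra.
have /andP[p1 p2] := angle_itv p; have /andP[q1 q2] := angle_itv q.
by apply: (folded_arc_distortion (l / 2) m); rewrite ?p2 ?q2 ?andbT //;
  try split; lra.
Qed.

End UpperBound.

Theorem theorem6p8 (R : realType) (lambda : R) (lambda_ge0 : 0 <= lambda) :
  [/\ lambda <= 2 / 3 * pi ->
        dGH (segment lambda) (circle R) = (pi / 2 - lambda / 4)%:E,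
      2 / 3 * pi <= lambda <= 5 / 3 * pi ->
        dGH (segment lambda) (circle R) = (pi / 3)%:E
    & 5 / 3 * pi <= lambda ->
        dGH (segment lambda) (circle R) = ((lambda - pi) / 2)%:E].
Proof.
have p0 := pi_gt0 R; split => [l1|/andP[l1 l2]|l1].
- rewrite (_ : pi / 2 - lambda / 4 = (pi - lambda / 2) / 2); last lra.
  apply: dGH_eq_half => [C CC|]; first exact: distortion_ge_midpoint.
  by apply: small_distortion_correspondence; lra.
- rewrite (_ : pi / 3 = 2 / 3 * pi / 2); last lra.
  apply: dGH_eq_half => [C CC|]; first exact: distortion_ge_circle_line.
  by apply: small_distortion_correspondence; lra.
- apply: dGH_eq_half => [C CC|]; first exact: distortion_ge_diam.
  by apply: small_distortion_correspondence; lra.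
Qed.
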